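(* Let $q>1$ be a squarefree integer and let $(a_1,b_1,c_1)$ be a base hit in $F_q$, with $d_1=R(a_1)$, $d_2=R(b_1)$, $d_3=R(c_1)$. Then: (i) there exists an infinite strictly increasing sequence $\Phi(c_1,d_1,d_2)=\{c_1,c_2,c_3,\dots\}$, beginning with $c_1$, such that each $c_i$ is the third entry of an $abc$ hit $(a_i,b_i,c_i)$ with $R(a_i)=d_1$ and $R(b_i)=d_2$, and each $c_i$ lies in $F_{sq}$ for some squarefree $s\ge1$ with $\gcd(s,q)=1$; (ii) there exists an infinite strictly increasing sequence $\Psi(c_1,d_1,d_3)=\{c_1,c_2,c_3,\dots\}\subset F_q$, beginning with $c_1$, such that each $c_j$ is the third entry of an $abc$ hit $(a_j,b_j,c_j)$ with $R(a_j)=d_1$ and $R(c_j)=d_3$.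
   Context: For a positive integer $n$, the radical is $R(n)=\prod_{p\mid n}p$ (product over the distinct primes dividing $n$), with $R(1)=1$, and $Q(n)=n/R(n)$. An $abc$ triple is a triple of pairwise coprime positive integers $(a,b,c)$ with $a+b=c$ and $1\le a<b<c$; it is an $abc$ hit if moreover $R(abc)<c$. For a squarefree integer $m>1$, $F_m$ is the set of integers $c>2$ with $R(Q(c))=m$. A base hit in $F_m$ is an $abc$ hit $(a,b,c)$ with $c\in F_m$ such that $c$ is minimal among the third entries, lying in $F_m$, of all $abc$ hits $(a',b',c')$ with $R(a')=R(a)$ and $R(b')=R(b)$. *)

(* Defs.v *)
From mathcomp Require Import all_boot.
Set Implicit Arguments.
Unset Strict Implicit.
Unset Printing Implicit Defensive.

Definition radical (n : nat) : nat := \prod_(p <- primes n) p.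

(* The division is exact, since radical n %| n. *)
Definition radical_quotient (n : nat) : nat := n %/ radical n.

(* In particular 0 is not squarefree. *)
Definition squarefree (n : nat) : Prop := forall d : nat, d ^ 2 %| n -> d = 1.

Definition abc_triple (a b c : nat) : Prop :=
  [/\ [&& coprime a b, coprime a c & coprime b c], a + b = c, 1 <= a & a < b < c].

Definition abc_hit (a b c : nat) : Prop :=
  abc_triple a b c /\ radical (a * b * c) < c.

(* The set F_m; it is only meant for squarefree m > 1. *)
Definition in_F (m c : nat) : Prop := 2 < c /\ radical (radical_quotient c) = m.

Definition base_hit (m a b c : nat) : Prop :=
  [/\ abc_hit a b c,
      in_F m c
    & forall a' b' c' : nat,
        abc_hit a' b' c' -> radical a' = radical a -> radical b' = radical b ->
        in_F m c' -> c <= c'].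

(* Main.v *)
(* (i) The powers [a1 ^ i + b1 ^ i] with [i] odd are multiples of [c1], so their
   radical quotients are multiples of that of [c1].  A triple is a hit exactly when
   the radical quotient of [c] exceeds [radical a * radical b], and a multiple of
   [radical_quotient c1] has a radical of the form [s * q].
   (ii) Take [a = a1 * X ^ u] and [c = c1 * Y ^ t], where [X = a1 ^ phi] and
   [Y = q ^ phi] are 1 modulo [b1]; then [b1] divides [b = c - a], so
   [radical b <= radical b1 * (b / b1)].  This gives a hit as soon as
   [b / c <= b1 / c1], that is [Y ^ t <= X ^ u], while [a < b] needs
   [2 * a1 * X ^ u < c1 * Y ^ t].  There are arbitrarily large such [u, t] because
   the ratios [X ^ u / Y ^ t] accumulate at 1 from above.  If [a1 = 1], then [X = 1], but the
   integer [radical (a1 * b1 * c1) < c1] is at most [b1], which suffices. *)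

Require Import Defs.
From mathcomp Require Import all_boot cyclic.
From mathcomp Require Import zify ring.

(** * Radicals, squarefree numbers and radical quotients *)

Lemma prod_primes_dvd (s : seq nat) (k : nat) :
  uniq s -> all prime s -> (\prod_(p <- s) p %| k) = all (fun p => p %| k) s.
Proof.
elim: s => [|p s IHs] /=; first by rewrite big_nil dvd1n.
case/andP=> p_s Us /andP[p_pr s_pr]; rewrite big_cons Gauss_dvd ?IHs //.
rewrite coprime_sym; elim: s p_s s_pr {IHs Us} => [|r s IHs] /=.
  by rewrite big_nil coprime1n.
rewrite inE negb_or => /andP[neq_pr p_s] /andP[r_pr s_pr].
by rewrite big_cons coprimeMl IHs // prime_coprime // dvdn_prime2 // eq_sym neq_pr.
Qed.

Lemma all_prime_primes (n : nat) : all prime (primes n).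
Proof. by apply/allP=> p; rewrite mem_primes => /andP[]. Qed.

Lemma radical_dvdP (n k : nat) :
  reflect (forall p, p \in primes n -> p %| k) (radical n %| k).
Proof.
rewrite /radical prod_primes_dvd ?primes_uniq ?all_prime_primes //.
exact: allP.
Qed.

Lemma radical_dvd (n : nat) : radical n %| n.
Proof. by apply/radical_dvdP=> p; rewrite mem_primes => /and3P[]. Qed.

Lemma radical_gt0 (n : nat) : 0 < radical n.
Proof.
(* [primes 0] is empty, so [radical 0] is 1. *)
have [->|n_gt0] := posnP n; last exact: dvdn_gt0 n_gt0 (radical_dvd n).
by rewrite /radical big_nil.
Qed.

Lemma dvdn_radical (p n : nat) : p \in primes n -> p %| radical n.
Proof. by move=> p_n; apply: (elimT (radical_dvdP n _) (dvdnn _)). Qed.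

Lemma eq_radical (m n : nat) : primes m =i primes n -> radical m = radical n.
Proof.
by move=> eq_mn; apply: perm_big; apply: uniq_perm; rewrite ?primes_uniq.
Qed.

Lemma radical_dvd_mono (m n : nat) : 0 < n -> m %| n -> radical m %| radical n.
Proof.
move=> n_gt0 m_n; apply/radical_dvdP=> p; rewrite mem_primes => /and3P[p_pr _ p_m].
by apply: dvdn_radical; rewrite mem_primes p_pr n_gt0 (dvdn_trans p_m).
Qed.

Lemma radicalM_coprime (m n : nat) :
  0 < m -> 0 < n -> coprime m n -> radical (m * n) = radical m * radical n.
Proof.
move=> m_gt0 n_gt0 co_mn; rewrite /radical -big_cat; apply: perm_big.
apply: uniq_perm; rewrite ?primes_uniq // ?cat_uniq ?primes_uniq /=.
  by rewrite andbT -coprime_has_primes.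
by move=> p; rewrite primesM // mem_cat.
Qed.

(** This crude bound gives both the monotonicity of the radical quotient and the estimate of
    [radical b'] for a multiple [b'] of [b]. *)
Lemma radicalM_dvd (m n : nat) : 0 < m -> 0 < n -> radical (m * n) %| radical m * n.
Proof.
move=> m_gt0 n_gt0; apply/radical_dvdP=> p; rewrite primesM // => /orP[]p_mn.
  exact/dvdn_mulr/dvdn_radical.
by apply/dvdn_mull; move: p_mn; rewrite mem_primes => /and3P[].
Qed.

Lemma radicalX (m k : nat) : 0 < k -> radical (m ^ k) = radical m.
Proof. by move=> k_gt0; rewrite /radical primesX. Qed.

Lemma squarefree_radical (n : nat) : squarefree (radical n).
Proof.
move=> d d2_n; have [//|d_neq1] := eqVneq d 1; exfalso; move: d2_n.
have [->|d_gt0] := posnP d; first by rewrite dvd0n; have := radical_gt0 n; case: (radical n).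
have p_pr : prime (pdiv d) by apply: pdiv_prime; lia.
move=> d2_n.
have p2_n := dvdn_trans (dvdn_exp2r 2 (pdiv_dvd d)) d2_n.
have p_n : pdiv d %| n.
  by apply: dvdn_trans (radical_dvd n); apply: dvdn_trans p2_n; apply: dvdn_mulr.
have [n0|n_gt0] := posnP n.
  by move: p2_n; rewrite n0 /radical big_nil dvdn1 -mulnn; have := prime_gt1 p_pr; nia.
have p_in : pdiv d \in primes n by rewrite mem_primes p_pr n_gt0.
(* Cancelling one factor [pdiv d] would leave it dividing the product of the other primes of [n],
   all distinct from it. *)
move: p2_n; rewrite /radical (big_rem _ p_in) /= dvdn_pmul2l ?prime_gt0 //.
apply/negP; rewrite -prime_coprime //.
rewrite big_seq; elim/big_rec: _ => [|r x r_in]; first exact: coprimen1.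
rewrite coprimeMr => ->; rewrite andbT prime_coprime // dvdn_prime2 //.
  by apply: contraTN r_in => /eqP <-; rewrite mem_rem_uniq ?primes_uniq // inE eqxx.
by apply: (allP (all_prime_primes n)); apply: mem_rem r_in.
Qed.

Lemma squarefree_coprime (m n : nat) : squarefree (m * n) -> coprime m n.
Proof.
move=> sq; rewrite /coprime; apply/eqP/sq.
by rewrite expnS expn1 dvdn_mul ?dvdn_gcdl ?dvdn_gcdr.
Qed.

Lemma squarefree_dvd (m n : nat) : m %| n -> squarefree n -> squarefree m.
Proof. by move=> m_n sq d d_m; apply: sq; apply: dvdn_trans m_n. Qed.

Lemma radical_quotientK (n : nat) : radical_quotient n * radical n = n.
Proof. exact: divnK (radical_dvd n). Qed.

Lemma radical_quotient_gt0 (n : nat) : 0 < n -> 0 < radical_quotient n.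
Proof. by rewrite -{1}(radical_quotientK n) muln_gt0 => /andP[]. Qed.

(** With [n = k * m], the cofactor [z] in [k * radical m = z * radical n] is also the ratio of the
    two radical quotients. *)
Lemma radical_quotient_dvd (m n : nat) :
  0 < n -> m %| n -> radical_quotient m %| radical_quotient n.
Proof.
move=> n_gt0 /dvdnP[k def_n]; rewrite {}def_n in n_gt0 *.
have [k_gt0 m_gt0] : 0 < k /\ 0 < m by apply/andP; rewrite -muln_gt0.
have := radicalM_dvd m k m_gt0 k_gt0; rewrite mulnC => /dvdnP[z def_z].
apply/dvdnP; exists z; apply/eqP.
rewrite -(eqn_pmul2r (radical_gt0 (k * m))) radical_quotientK.
by rewrite mulnAC -def_z -{1}(radical_quotientK m); apply/eqP; lia.
Qed.

(** The sequence iterates a choice of a point with larger [f]; [xchoose] asks for a [choiceType] and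
    a boolean [P]. *)
Lemma increasing_sequence (T : choiceType) (P : pred T) (f : T -> nat) (x0 : T) :
  P x0 -> (forall C, exists x, P x && (C < f x)) ->
  exists g : nat -> T,
    [/\ g 0 = x0, forall i, P (g i) & forall i j, i < j -> f (g i) < f (g j)].
Proof.
move=> Px0 Pinf; pose next x := xchoose (Pinf (f x)).
have nextP x : P (next x) && (f x < f (next x)) by apply: (xchooseP (Pinf (f x))).
exists (fun i => iter i next x0); split=> // [[|i]|i j] //.
  by rewrite iterS; case/andP: (nextP (iter i next x0)).
elim: j => // j IHj; rewrite ltnS leq_eqVlt iterS.
have /andP[_ lt_j] := nextP (iter j next x0).
by case/predU1P=> [->//|/IHj lt_ij]; apply: ltn_trans lt_j.
Qed.

(** * Ratios of powers close to 1 *)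

Lemma pigeonhole_nat (f : nat -> nat) (N : nat) :
  (forall i, f i < N) -> exists i j, i < j /\ f i = f j.
Proof.
move=> ltfN; pose g (i : 'I_N.+1) := Ordinal (ltfN i).
have /injectivePn[i [j neq_ij [eq_f]]] : ~~ injectiveb g.
  by apply/negP=> /injectiveP/leq_card; rewrite !card_ord ltnn.
have [lt_ij|lt_ji|eq_ij] := ltngtP i j; first by exists i, j.
  by exists j, i.
by case/eqP: neq_ij; apply: val_inj.
Qed.

(* Pigeonhole on the integer part of [m * X ^ u / Y ^ t], where [Y ^ t <= X ^ u < Y ^ t.+1]. *)
Lemma expn_ratio_near1 (X Y m T : nat) : 1 < X -> 1 < Y -> 0 < m -> 0 < T ->
  exists u t, [/\ T <= u, m * X ^ u < m.+1 * Y ^ t & m * Y ^ t < m.+1 * X ^ u].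
Proof.
move=> X_gt1 Y_gt1 m_gt0 T_gt0; pose lg u := trunc_log Y (X ^ u).
pose f u := (m * X ^ u) %/ Y ^ lg u.
have X_gt0 u : 0 < X ^ u by rewrite expn_gt0 ltnW.
have Y_gt0 u : 0 < Y ^ u by rewrite expn_gt0 ltnW.
have lgP u : Y ^ lg u <= X ^ u < Y * Y ^ lg u.
  by rewrite -expnS; apply: trunc_log_bounds.
(* Only multiples of [T] are sampled, so distinct exponents differ by at least [T]. *)
have ltfN i : f (T * i) < m * Y.
  rewrite ltn_divLR // -mulnA ltn_pmul2l //; by case/andP: (lgP (T * i)).
have [i [j [lt_ij eq_f]]] := pigeonhole_nat _ _ ltfN.
set u1 := T * i in eq_f; set u2 := T * j in eq_f.
have lt_u : u1 + T <= u2 by rewrite /u1 /u2 addnC -mulnS leq_mul2l lt_ij orbT.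
have le_u : u1 <= u2 by lia.
have le_lg : lg u1 <= lg u2 by apply/leq_trunc_log/leq_pexp2l => //; lia.
(* Equal integer parts put the two quotients within 1 of each other; [Y ^ lg b <= X ^ b] turns this
   gap into the factor [m.+1 / m]. *)
have cross a b : f a = f b ->
    m * X ^ a * Y ^ lg b < m.+1 * X ^ b * Y ^ lg a.
  move=> eq_ab; have := lgP b; have := ltn_ceil (m * X ^ a) (Y_gt0 (lg a)).
  have := leq_divM (m * X ^ b) (Y ^ lg b); rewrite -/(f a) -/(f b) eq_ab.
  move: (f b) (Y_gt0 (lg a)) (Y_gt0 (lg b)) => z Ya Yb le_b lt_a /andP[le_YX _].
  have : m * X ^ a * Y ^ lg b < z.+1 * Y ^ lg a * Y ^ lg b by rewrite ltn_pmul2r.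
  move/leq_trans; apply; rewrite mulnAC leq_mul2r; apply/orP; right.
  by rewrite !mulSn leq_add.
have split_X : X ^ u2 = X ^ (u2 - u1) * X ^ u1 by rewrite -expnD subnK.
have split_Y : Y ^ lg u2 = Y ^ (lg u2 - lg u1) * Y ^ lg u1 by rewrite -expnD subnK.
have AB_gt0 : 0 < X ^ u1 * Y ^ lg u1 by rewrite muln_gt0 X_gt0 Y_gt0.
exists (u2 - u1), (lg u2 - lg u1); split; first lia.
  have := cross u2 u1 (esym eq_f); rewrite split_X split_Y => lt.
  by rewrite -(ltn_pmul2r AB_gt0); apply: etrans lt; congr (_ < _); ring.
have := cross u1 u2 eq_f; rewrite split_X split_Y => lt.
by rewrite -(ltn_pmul2r AB_gt0); apply: etrans lt; congr (_ < _); ring.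
Qed.

(** Bernoulli's inequality [1 + k / A <= (1 + 1 / A) ^ k], cleared of denominators and taken at
    [k = A * N]. *)
Lemma expn_ratio_unbounded (A B N : nat) : A < B -> exists k, N * A ^ k < B ^ k.
Proof.
move=> ltAB; have [->|A_gt0] := posnP A; first by exists 1; rewrite muln0 expn1; lia.
exists (A * N); have bern k : (A + k) * A ^ k <= A * A.+1 ^ k.
  by elim: k => [|k IHk]; rewrite ?addn0 // !expnS; nia.
apply: (@leq_trans (A.+1 ^ (A * N))); last by case: (A * N) => // e; rewrite leq_exp2r.
rewrite -(ltn_pmul2l A_gt0); apply: leq_trans (bern _).
by rewrite mulnA ltn_mul2r expn_gt0 A_gt0; lia.
Qed.

(* The powers [X ^ u / Y ^ t] accumulate at 1; when only ratios below 1 are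
   found there, multiplying a large power of such a ratio by some [Y ^ s]
   brings it back just above 1. *)
Lemma expn_ratio_above1 (X Y m C : nat) : 1 < X -> 1 < Y -> 0 < m ->
  exists u t, [/\ C < Y ^ t, Y ^ t <= X ^ u & m * X ^ u < m.+1 * Y ^ t].
Proof.
move=> X_gt1 Y_gt1 m_gt0.
have ratio_lt2 x y : m * x < m.+1 * y -> x < 2 * y by nia.
(* Here [u < X ^ u < 2 * Y ^ t]. *)
have large u t : C.*2 < u -> m * X ^ u < m.+1 * Y ^ t -> C < Y ^ t.
  by move=> ltCu /ratio_lt2; have := ltn_expl u X_gt1; lia.
have [//|u [t [u_large lt_ut lt_tu]]] :=
  expn_ratio_near1 X Y m C.*2.+1 X_gt1 Y_gt1 m_gt0.
have [le_tu|lt_XY] := leqP (Y ^ t) (X ^ u).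
  by exists u, t; split=> //; apply: large lt_ut.
have [k0 k0P] := expn_ratio_unbounded (X ^ u) (Y ^ t) (Y ^ C.*2.+1) lt_XY.
pose above k := Y ^ C.*2.+1 * (X ^ u) ^ k < (Y ^ t) ^ k.
(* [k.+1] is the first exponent at which the scaled power drops below 1. At [k] it is still at least
   1, and undoing one factor [X ^ u / Y ^ t] keeps it below [m.+1 / m]. *)
have [[|k] lt_k min_k] := ex_minnP (ex_intro above k0 k0P).
  by move: lt_k; rewrite /above muln1 ltnNge expn_gt0 ltnW.
have {min_k} le_k : (Y ^ t) ^ k <= Y ^ C.*2.+1 * (X ^ u) ^ k.
  by rewrite leqNgt; apply/negP=> /min_k; rewrite ltnn.
have lt_above : m * (Y ^ C.*2.+1 * (X ^ u) ^ k) < m.+1 * (Y ^ t) ^ k.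
  have Xu_gt0 : 0 < X ^ u by rewrite expn_gt0 ltnW.
  rewrite -(ltn_pmul2l Xu_gt0).
  apply: (@ltn_trans (m * Y ^ t * (Y ^ t) ^ k)).
    rewrite -mulnA -expnS mulnCA ltn_pmul2l // mulnCA -expnS.
    exact: lt_k.
  by rewrite mulnA ltn_pmul2r ?[_ * m.+1]mulnC // !expn_gt0 ltnW.
(* Each factor [Y ^ t / X ^ u] is below 2, yet [k.+1] of them exceed [Y ^ C.*2.+1], which is at
   least [2 ^ C.*2.+1]. *)
have le_sk : C.*2 < k.
  have lt_2k : Y ^ C.*2.+1 < 2 ^ k.+1.
    have Xk_gt0 : 0 < (X ^ u) ^ k.+1 by rewrite !expn_gt0 ltnW.
    rewrite -(ltn_pmul2r Xk_gt0) -expnMn; apply: leq_trans lt_k _.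
    by rewrite leq_exp2r // ltnW // ratio_lt2.
  rewrite -ltnS -(@ltn_exp2l 2) //; apply: leq_ltn_trans lt_2k.
  by rewrite leq_exp2r.
(* This makes the subtraction in the final exponent exact: otherwise a spare factor [Y >= 2] would
   contradict the ratio being below 2. *)
have le_stk : C.*2.+1 <= t * k.
  rewrite leqNgt; apply/negP=> lt_tks; have := ratio_lt2 _ _ lt_above.
  rewrite -!expnM ltnNge => /negP; apply.
  apply: (@leq_trans (Y ^ (t * k).+1)); first by rewrite expnS leq_mul2r Y_gt1 orbT.
  by rewrite -[leqLHS]muln1 leq_mul ?expn_gt0 ?(ltnW X_gt1) // leq_exp2l.
have eq_t : (Y ^ t) ^ k = Y ^ (t * k - C.*2.+1) * Y ^ C.*2.+1.
  by rewrite -expnD subnK // expnM.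
have s_gt0 : 0 < Y ^ C.*2.+1 by rewrite expn_gt0 ltnW.
have lt_uk : m * X ^ (u * k) < m.+1 * Y ^ (t * k - C.*2.+1).
  rewrite -(ltn_pmul2r s_gt0) -!mulnA -eq_t [_ * Y ^ _]mulnC expnM.
  exact: lt_above.
exists (u * k), (t * k - C.*2.+1); split=> //.
  by apply: large lt_uk; nia.
rewrite -(leq_pmul2r s_gt0) -eq_t expnM mulnC; exact: le_k.
Qed.

(** * Hits, odd powers and the sets [F_m] *)

(** With [n] odd, the induction uses [a ^ (n + 2) + b ^ (n + 2) = a ^ 2 * (a ^ n + b ^ n) + b ^ n *
    (b ^ 2 - a ^ 2)]; assuming [a <= b] keeps the subtraction exact. *)
Lemma dvdn_addX_odd (a b i : nat) : a + b %| a ^ i.*2.+1 + b ^ i.*2.+1.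
Proof.
wlog le_ab : a b / a <= b.
  by move=> IH; have [|/ltnW] := leqP a b => /IH //; rewrite addnC [_ ^ _ + _]addnC.
elim: i => // i IHi.
have -> : a ^ i.+1.*2.+1 + b ^ i.+1.*2.+1
  = a ^ 2 * (a ^ i.*2.+1 + b ^ i.*2.+1) + b ^ i.*2.+1 * (b ^ 2 - a ^ 2).
  have le_sq : b ^ i.*2.+1 * a ^ 2 <= b ^ i.*2.+1 * b ^ 2 by rewrite leq_mul2l leq_sqr le_ab orbT.
  rewrite doubleS -[i.*2.+3]addn2 !expnD mulnBr; lia.
by rewrite dvdn_add ?dvdn_mull // subn_sqr addnC dvdn_mull.
Qed.

Lemma abc_triple_gt0 (a b c : nat) : abc_triple a b c -> [/\ 0 < a, 0 < b & 0 < c].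
Proof. by case=> _ _ a_gt0 /andP[lt_ab lt_bc]; split; lia. Qed.

Lemma abc_triple_radical (a b c : nat) : abc_triple a b c ->
  radical (a * b * c) = radical a * radical b * radical c.
Proof.
move=> abc; have [a_gt0 b_gt0 c_gt0] := abc_triple_gt0 _ _ _ abc.
case: abc => /and3P[co_ab co_ac co_bc] _ _ _.
by rewrite !radicalM_coprime ?muln_gt0 ?a_gt0 // coprimeMl co_ac.
Qed.

Lemma abc_hit_quotient (a b c : nat) : abc_triple a b c ->
  (radical (a * b * c) < c) = (radical a * radical b < radical_quotient c).
Proof.
move=> /abc_triple_radical->.
by rewrite -{2}(radical_quotientK c) ltn_pmul2r // radical_gt0.
Qed.

Lemma abc_triple_coprime (a b : nat) :
  coprime a b -> 0 < a -> a < b -> abc_triple a b (a + b).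
Proof.
move=> co_ab a_gt0 lt_ab; split; rewrite ?lt_ab //=; last by lia.
have coD m n : coprime m (m + n) = coprime m n by rewrite /coprime gcdnDl.
by rewrite coD [a + b]addnC coD [coprime b a]coprime_sym co_ab.
Qed.

Lemma abc_hit_odd_power (a b c i : nat) : abc_hit a b c ->
  abc_hit (a ^ i.*2.+1) (b ^ i.*2.+1) (a ^ i.*2.+1 + b ^ i.*2.+1).
Proof.
case=> abc hit; have [a_gt0 b_gt0 c_gt0] := abc_triple_gt0 _ _ _ abc.
have [/and3P[co_ab _ _] def_c _ /andP[lt_ab _]] := abc.
have abc_i : abc_triple (a ^ i.*2.+1) (b ^ i.*2.+1) (a ^ i.*2.+1 + b ^ i.*2.+1).
  by apply: abc_triple_coprime; rewrite ?expn_gt0 ?a_gt0 ?ltn_exp2r // coprimeXl ?coprimeXr.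
split=> //; rewrite abc_hit_quotient // !radicalX //.
move: hit; rewrite abc_hit_quotient // => /leq_trans; apply.
apply: dvdn_leq; first by rewrite radical_quotient_gt0 // addn_gt0 expn_gt0 a_gt0.
by apply: radical_quotient_dvd; rewrite ?addn_gt0 ?expn_gt0 ?a_gt0 // -def_c dvdn_addX_odd.
Qed.

(** [s] is the cofactor of [q] in the radical of [radical_quotient c']; that radical is squarefree,
    hence [s] is squarefree and coprime to [q]. *)
Lemma in_F_dvd (q c c' : nat) : 0 < c' -> c %| c' -> in_F q c ->
  exists s, [/\ 1 <= s, squarefree s, gcdn s q = 1 & in_F (s * q) c'].
Proof.
move=> c'_gt0 c_c' [c_gt2 <-].
have Qc'_gt0 := radical_quotient_gt0 _ c'_gt0.
have /dvdnP[s def_s] := radical_dvd_mono _ _ Qc'_gt0 (radical_quotient_dvd _ _ c'_gt0 c_c').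
have sq : squarefree (s * radical (radical_quotient c)).
  by rewrite -def_s; apply: squarefree_radical.
exists s; split.
- by have := radical_gt0 (radical_quotient c'); rewrite def_s muln_gt0 => /andP[].
- by apply: squarefree_dvd sq; apply: dvdn_mulr.
- by apply/eqP; apply: squarefree_coprime.
- by split; [apply: leq_trans c_gt2 (dvdn_leq _ _) | rewrite def_s].
Qed.

(* As [b] divides [b'], [radical b'] is at most [radical b * (b' / b)]. *)
Lemma abc_hit_multiple (a b c x y b' q : nat) :
  abc_hit a b c -> in_F q c ->
  {subset primes x <= primes a} -> {subset primes y <= primes q} ->
  0 < x -> 0 < y -> x = 1 %[mod b] -> y = 1 %[mod b] ->
  (a * x).*2 < c * y -> b' = c * y - a * x ->
  radical (a * b * c) * b' < b * (c * y) ->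
  [/\ abc_hit (a * x) b' (c * y), radical (a * x) = radical a,
      radical (c * y) = radical c & in_F q (c * y)].
Proof.
move=> [abc hit] [c_gt2 def_q] sxa syq x_gt0 y_gt0 x1 y1 lt2 def_b' lt_b'.
have [a_gt0 b_gt0 c_gt0] := abc_triple_gt0 _ _ _ abc.
have [/and3P[co_ab co_ac co_bc] def_c _ /andP[lt_ab _]] := abc.
have sqc : {subset primes q <= primes c}.
  move=> p; rewrite !mem_primes -def_q => /and3P[-> _ p_q] /=; rewrite c_gt0.
  apply: dvdn_trans p_q _; apply: dvdn_trans (radical_dvd _) _.
  by rewrite -{2}(radical_quotientK c) dvdn_mulr.
have Rax : radical (a * x) = radical a.
  apply: eq_radical => p; rewrite primesM //.
  by apply/orb_idr/sxa.
have Rcy : radical (c * y) = radical c.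
  apply: eq_radical => p; rewrite primesM //.
  by apply/orb_idr=> /syq/sqc.
(* As [y] brings no new prime, all of it passes into the quotient. *)
have Qcy : radical_quotient (c * y) = radical_quotient c * y.
  by rewrite /radical_quotient Rcy divn_mulAC ?radical_dvd.
have Fcy : in_F q (c * y).
  split; first by apply: leq_trans c_gt2 _; apply: leq_pmulr.
  rewrite Qcy -def_q; apply: eq_radical => p; rewrite primesM ?radical_quotient_gt0 //.
  apply/orb_idr=> /syq; rewrite -def_q !mem_primes => /and3P[-> _ p_q].
  by rewrite radical_quotient_gt0 //= (dvdn_trans p_q) ?radical_dvd.
have co_axcy : coprime (a * x) (c * y).
  rewrite coprime_has_primes ?muln_gt0 ?a_gt0 ?c_gt0 //.
  move: co_ac; rewrite coprime_has_primes //; apply: contra => /hasP[p].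
  rewrite !primesM // => p_cy p_ax; apply/hasP; exists p.
    by case/orP: p_cy => // /syq/sqc.
  by case/orP: p_ax => // /sxa.
have def_cy : a * x + b' = c * y by lia.
have lt_axb' : a * x < b' by lia.
have ax_gt0 : 0 < a * x by rewrite muln_gt0 a_gt0.
have b'_gt0 : 0 < b' by lia.
have abc' : abc_triple (a * x) b' (c * y).
  rewrite -def_cy; apply: abc_triple_coprime => //.
  by move: co_axcy; rewrite -def_cy /coprime gcdnDl.
split=> //; split=> //.
(* Modulo [b], [c * y] is [c] and [a * x] is [a], while [c = a + b]. *)
have b_b' : b %| b'.
  rewrite def_b' -eqn_mod_dvd; last by lia.
  by rewrite -modnMmr y1 -[_ * x %% _]modnMmr x1 !modnMmr !muln1 -def_c modnDr.
have {b_b'} /dvdnP[k def_k] := b_b'.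
have k_gt0 : 0 < k by move: b'_gt0; rewrite def_k muln_gt0 => /andP[].
have le_Rb' : radical b' <= radical b * k.
  rewrite def_k mulnC; apply: dvdn_leq (radicalM_dvd _ _ _ _) => //.
  by rewrite muln_gt0 radical_gt0.
(* Multiplying by [b] clears the quotient [k = b' / b] and leaves [lt_b']. *)
rewrite abc_triple_radical // Rax Rcy -(ltn_pmul2l b_gt0).
apply: leq_ltn_trans lt_b'; rewrite abc_triple_radical // {2}def_k.
have := leq_mul le_Rb' (leqnn (b * radical a * radical c)).
by move=> le; apply: etrans le; congr (_ <= _); ring.
Qed.

Theorem lemma3 (q a1 b1 c1 d1 d2 d3 : nat) (hq1 : 1 < q) (hq : squarefree q)
    (hbase : base_hit q a1 b1 c1)
    (hd1 : d1 = radical a1) (hd2 : d2 = radical b1) (hd3 : d3 = radical c1) :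
  (exists a b c : nat -> nat,
     [/\ [/\ a 0 = a1, b 0 = b1 & c 0 = c1],
         forall i j : nat, i < j -> c i < c j
       & forall i : nat,
           [/\ abc_hit (a i) (b i) (c i),
               radical (a i) = d1,
               radical (b i) = d2
             & exists s : nat,
                 [/\ 1 <= s, squarefree s, gcdn s q = 1 & in_F (s * q) (c i)]]])
  /\
  (exists a b c : nat -> nat,
     [/\ [/\ a 0 = a1, b 0 = b1 & c 0 = c1],
         forall i j : nat, i < j -> c i < c j
       & forall j : nat,
           [/\ abc_hit (a j) (b j) (c j),
               radical (a j) = d1,
               radical (c j) = d3
             & in_F q (c j)]]).
Proof.
have [hit Fc _] := hbase; have [abc lt_rad] := hit.
have [a_gt0 b_gt0 c_gt0] := abc_triple_gt0 _ _ _ abc.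
have [/and3P[co_ab _ co_bc] def_c _ /andP[lt_ab _]] := abc.
rewrite {}hd1 {}hd2 {}hd3; split.
  exists (fun i => a1 ^ i.*2.+1), (fun i => b1 ^ i.*2.+1).
  exists (fun i => a1 ^ i.*2.+1 + b1 ^ i.*2.+1); split=> [|i j lt_ij|i].
  - by rewrite !expn1.
  (* Strictness comes from the powers of [b1], since [a1] may be 1. *)
  - rewrite -addnS leq_add //; first by rewrite leq_pexp2l // ltnS leq_double ltnW.
    by rewrite ltn_exp2l ?ltnS ?ltn_double //; lia.
  - rewrite !radicalX //; split=> //; first exact: abc_hit_odd_power hit.
    apply: in_F_dvd Fc; first by rewrite addn_gt0 expn_gt0 a_gt0.
    by rewrite -def_c dvdn_addX_odd.
have co_qb : coprime q b1.
  rewrite coprime_sym; apply: coprime_dvdr co_bc; case: Fc => _ <-.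
  by apply: dvdn_trans (radical_dvd _) _; rewrite -{2}(radical_quotientK c1) dvdn_mulr.
pose X := a1 ^ totient b1; pose Y := q ^ totient b1.
have t_gt0 : 0 < totient b1 by rewrite totient_gt0.
have Y_gt1 : 1 < Y by rewrite -[1](exp1n (totient b1)) ltn_exp2r.
have Xmod u : X ^ u = 1 %[mod b1].
  by rewrite -modnXm Euler_exp_totient // modnXm exp1n.
have Ymod t : Y ^ t = 1 %[mod b1].
  by rewrite -modnXm Euler_exp_totient // modnXm exp1n.
have Xprimes u : {subset primes (X ^ u) <= primes a1}.
  by rewrite -expnM; case: (_ * u) => [|n] p //; rewrite primesX.
have Yprimes t : {subset primes (Y ^ t) <= primes q}.
  by rewrite -expnM; case: (_ * t) => [|n] p //; rewrite primesX.
have Y_gt0 t : 0 < Y ^ t by rewrite expn_gt0 ltnW.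
have [a_eq1|a_neq1] := eqVneq a1 1.
  exists (fun=> a1), (fun i => c1 * Y ^ i - a1), (fun i => c1 * Y ^ i).
  split=> [|i j lt_ij|i]; first by rewrite expn0 muln1 -def_c addKn.
    by rewrite ltn_pmul2l // ltn_exp2l.
  have le_c : c1 <= c1 * Y ^ i by apply: leq_pmulr.
  have := abc_hit_multiple a1 b1 c1 1 (Y ^ i) (c1 * Y ^ i - a1) q.
  rewrite muln1; apply=> //; first by lia.
  nia.
have a_gt1 : 1 < a1 by lia.
have X_gt1 : 1 < X by rewrite -[1](exp1n (totient b1)) ltn_exp2r.
have X_gt0 u : 0 < X ^ u by rewrite expn_gt0 ltnW.
(* Since [a1 < b1], [a1.*2.+1 <= c1]; so the upper bound on [X ^ w.1] gives
   [2 * a1 * X ^ w.1 < c1 * Y ^ w.2]. *)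
pose P (w : nat * nat) := (Y ^ w.2 <= X ^ w.1) && (a1.*2 * X ^ w.1 < a1.*2.+1 * Y ^ w.2).
(* Zero exponents give back the base hit as the initial term. *)
have P0 : P (0, 0) by rewrite /P /=; lia.
have Pinf C : exists w, P w && (C < Y ^ w.2).
  have [|u [t [ltC le_t lt_u]]] := expn_ratio_above1 X Y a1.*2 C X_gt1 Y_gt1; first by lia.
  by exists (u, t); rewrite /P /= le_t lt_u.
have [g [g0 gP g_lt]] := increasing_sequence _ P (fun w => Y ^ w.2) _ P0 Pinf.
pose a i := a1 * X ^ (g i).1; pose c i := c1 * Y ^ (g i).2.
exists a, (fun i => c i - a i), c; split=> [|i j lt_ij|i].
- by rewrite /a /c g0 /= !muln1 -def_c addKn.
- by rewrite ltn_pmul2l // g_lt.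
have /andP[le_YX lt_XY] := gP i.
have Xi_gt0 := X_gt0 (g i).1; have Yi_gt0 := Y_gt0 (g i).2.
have lt2 : (a1 * X ^ (g i).1).*2 < c1 * Y ^ (g i).2.
  by rewrite -muln2 mulnAC muln2; apply: leq_trans lt_XY _; rewrite leq_mul2r; lia.
have lt_ac : a i < c i by have : (a i).*2 < c i := lt2; lia.
apply: (abc_hit_multiple a1 b1) lt2 _ _ => //.
rewrite -/(c i) -/(a i).
(* The strict step is [radical (a1 * b1 * c1) < c1]; then [Y ^ t <= X ^ u] gives [c i - a i <= (c1 -
   a1) * Y ^ t = b1 * Y ^ t], where [(u, t)] is [g i]. *)
apply: (@leq_trans (c1 * (c i - a i))); first by rewrite ltn_pmul2r // subn_gt0.
apply: (@leq_trans (c1 * (b1 * Y ^ (g i).2))); last by rewrite mulnCA.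
rewrite leq_mul2l; apply/orP; right.
by rewrite leq_subLR /c -def_c mulnDl leq_add2r /a leq_mul2l le_YX orbT.
Qed.
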